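(* Let the prior joint distribution of the losses $(X,Y)$ be bivariate normal $\mathcal{N}(\boldsymbol{\mu},\boldsymbol{\Sigma})$ with $\boldsymbol{\mu}=(\mu_X,\mu_Y)^\top$, $\boldsymbol{\Sigma}=\begin{pmatrix}\sigma_X^2 & \rho\sigma_X\sigma_Y\\ \rho\sigma_X\sigma_Y & \sigma_Y^2\end{pmatrix}$, $\sigma_X,\sigma_Y>0$, $|\rho|<1$. Let $\mu_1\in\mathbb{R}$, $\alpha\in(0,1)$, and let $\tilde\mu_X$ denote the posterior expectation of $X$ (under the entropy-pooling posterior described in the context). (i) Under the equality view $\tilde\mu_X=\mu_1$, $$\mathrm{CoVaR}_\alpha^{Y|\tilde\mu_X=\mu_1}=\mu_Y+\rho(\mu_1-\mu_X)\frac{\sigma_Y}{\sigma_X}+\sigma_Y\Phi^{-1}(\alpha).$$ (ii) Under the inequality view $\tilde\mu_X\le\mu_1$: if $\mu_X\le\mu_1$, then $\mathrm{CoVaR}_\alpha^{Y|\tilde\mu_X\le\mu_1}=\mathrm{VaR}_\alpha^Y$; if $\mu_X>\mu_1$, then $\mathrm{CoVaR}_\alpha^{Y|\tilde\mu_X\le\mu_1}=\mathrm{CoVaR}_\alpha^{Y|\tilde\mu_X=\mu_1}$. (iii) Under the inequality view $\tilde\mu_X\ge\mu_1$: if $\mu_X\ge\mu_1$, then $\mathrm{CoVaR}_\alpha^{Y|\tilde\mu_X\ge\mu_1}=\mathrm{VaR}_\alpha^Y$; if $\mu_X<\mu_1$, then $\mathrm{CoVaR}_\alpha^{Y|\tild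e\mu_X\ge\mu_1}=\mathrm{CoVaR}_\alpha^{Y|\tilde\mu_X=\mu_1}$.
   Context: Entropy-pooling framework: given a ''view'' $V$ (a constraint on the posterior parameters), the posterior distribution of $(X,Y)$ is the bivariate normal distribution $\mathcal{N}(\tilde{\boldsymbol{\mu}},\tilde{\boldsymbol{\Sigma}})$, with $\tilde{\boldsymbol{\mu}}=(\tilde\mu_X,\tilde\mu_Y)^\top$ and nonsingular $\tilde{\boldsymbol{\Sigma}}=\begin{pmatrix}\tilde\sigma_X^2 & \tilde\rho\tilde\sigma_X\tilde\sigma_Y\\ \tilde\rho\tilde\sigma_X\tilde\sigma_Y & \tilde\sigma_Y^2\end{pmatrix}$, that minimizes the relative entropy (Kullback–Leibler divergence) $\varepsilon(\tilde f,f)=\int \tilde f\,(\ln\tilde f-\ln f)$ of its density $\tilde f$ with respect to the prior density $f$, among all bivariate normal distributions satisfying $V$. The general CoVaR under view $V$ is the $\alpha$-quantile of the posterior marginal of $Y$: $\mathrm{CoVaR}_\alpha^{Y|V}=\tilde\mu_Y+\tilde\sigma_Y\Phi^{-1}(\alpha)$, where $\Phi$ is the standard normal cdf. $\mathrm{VaR}_\alpha^Y=\mu_Y+\sigma_Y\Phi^{-1}(\alpha)$ is the prior $\alpha$-quantile of $Y$. *)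

(* Defs.v *)
From HB Require Import structures.
From mathcomp Require Import all_boot all_order all_algebra.
From mathcomp Require Import all_classical all_reals all_analysis.
Set Implicit Arguments. Unset Strict Implicit. Unset Printing Implicit Defensive.
Import Order.TTheory GRing.Theory Num.Def Num.Theory.
Import numFieldNormedType.Exports.
Local Open Scope classical_set_scope.
Local Open Scope ring_scope.

Section defs.
Variable R : realType.

(* Parameters of a bivariate normal N(mu, Sigma) with
   Sigma = [[sX^2, rho sX sY]; [rho sX sY, sY^2]]. *)
Record gparams := GP { muX : R; muY : R; sigX : R; sigY : R; rho : R }.

Definition admissible (p : gparams) : Prop :=
  0 < sigX p /\ 0 < sigY p /\ `|rho p| < 1.

Definition binorm_pdf (p : gparams) (z : R * R) : R :=
  let u := (z.1 - muX p) / sigX p in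
  let v := (z.2 - muY p) / sigY p in
  (pi *+ 2 * sigX p * sigY p * Num.sqrt (1 - rho p ^+ 2))^-1 *
  expR (- (u ^+ 2 - (rho p *+ 2) * u * v + v ^+ 2) / ((1 - rho p ^+ 2) *+ 2)).

Definition rel_entropy (pt p : gparams) : \bar R :=
  (\int[(@lebesgue_measure R) \x (@lebesgue_measure R)]_z
     (binorm_pdf pt z * (ln (binorm_pdf pt z) - ln (binorm_pdf p z)))%:E)%E.

Definition is_posterior (p : gparams) (V : gparams -> Prop) (pt : gparams) : Prop :=
  admissible pt /\ V pt /\
  forall q, admissible q -> V q -> (rel_entropy pt p <= rel_entropy q p)%E.

Definition Phi (t : R) : R := fine (normal_prob 0 1 `]-oo, t]).
Definition Phi_inv (a : R) : R := inf [set t | a <= Phi t].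

Definition CoVaR (a : R) (pt : gparams) : R := muY pt + sigY pt * Phi_inv a.
Definition VaR (a : R) (p : gparams) : R := muY p + sigY p * Phi_inv a.

Definition view_eq (m1 : R) (q : gparams) : Prop := muX q = m1.
Definition view_le (m1 : R) (q : gparams) : Prop := muX q <= m1.
Definition view_ge (m1 : R) (q : gparams) : Prop := m1 <= muX q.

End defs.

(* Main.v *)
Require Import Defs.
From HB Require Import structures.
From mathcomp Require Import all_boot all_order all_algebra.
From mathcomp Require Import all_classical all_reals all_analysis.
From mathcomp Require Import measurable_realfun ring lra.
Import Order.TTheory GRing.Theory Num.Def Num.Theory.
Local Open Scope ring_scope.

(* For u = (x - muX) / sigX, the density f exp (d u - d^2 / 2) is again
   binormal: the covariance is that of the prior f, mean X is shifted by
   d sigX and mean Y by rho d sigY. Writing f_d for it, every binormal g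
   satisfies the Pythagorean identity
   KL(g, f) = KL(f_d, f) + KL(g, f_d) + d (E_g X - E_(f_d) X) / sigX.
   Under each view a suitable d (the one with tilted mean m1, or d = 0 when the
   prior satisfies the view) makes the last term nonnegative, so f_d is the
   minimiser; by Gibbs' inequality any other minimiser has the same density,
   hence the same parameters for Y. *)

Section Binormal.
Import numFieldNormedType.Exports.
Local Open Scope classical_set_scope.
Variable R : realType.
Implicit Types (p q : gparams R) (z : R * R) (d : R) (g : R * R -> R).

Local Notation leb2 := (lebesgue_measure \x lebesgue_measure)%E.

(** * The binormal density: standardised form, positivity, continuity, measurability *)

Definition std_x p z : R := (z.1 - muX p) / sigX p.
Definition std_y p z : R := (z.2 - muY p) / sigY p.

Definition binorm_quad p z : R :=
  (std_x p z ^+ 2 - (rho p *+ 2) * std_x p z * std_y p z + std_y p z ^+ 2) /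
  ((1 - rho p ^+ 2) *+ 2).

Definition binorm_norm p : R :=
  pi *+ 2 * sigX p * sigY p * Num.sqrt (1 - rho p ^+ 2).

Lemma binorm_pdfE p z :
  binorm_pdf p z = (binorm_norm p)^-1 * expR (- binorm_quad p z).
Proof. by rewrite /binorm_pdf mulNr. Qed.

Lemma subr1_rho_gt0 p : admissible p -> 0 < 1 - rho p ^+ 2.
Proof.
case=> _ [_ hr]; rewrite subr_gt0 -real_normK ?num_real//.
by rewrite expr_lt1.
Qed.

Lemma binorm_norm_gt0 p : admissible p -> 0 < binorm_norm p.
Proof.
move=> ap; have [sX [sY _]] := ap; rewrite /binorm_norm.
by rewrite !mulr_gt0 ?sqrtr_gt0 ?subr1_rho_gt0// pmulrn_lgt0 ?pi_gt0.
Qed.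

Lemma binorm_pdf_gt0 p z : admissible p -> 0 < binorm_pdf p z.
Proof.
by move=> ap; rewrite binorm_pdfE mulr_gt0 ?expR_gt0// invr_gt0 binorm_norm_gt0.
Qed.

Lemma ln_binorm_pdf p z : admissible p ->
  ln (binorm_pdf p z) = - ln (binorm_norm p) - binorm_quad p z.
Proof.
move=> ap; have n0 := binorm_norm_gt0 _ ap.
by rewrite binorm_pdfE lnM ?posrE ?invr_gt0 ?expR_gt0// lnV ?posrE// expRK.
Qed.

Lemma continuous_std_x p : continuous (std_x p).
Proof.
move=> z; apply: cvgM; last exact: cvg_cst.
by apply: cvgB; [exact: cvg_fst|exact: cvg_cst].
Qed.

Lemma continuous_std_y p : continuous (std_y p).
Proof.
move=> z; apply: cvgM; last exact: cvg_cst.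
by apply: cvgB; [exact: cvg_snd|exact: cvg_cst].
Qed.

Lemma continuous_binorm_quad p : continuous (binorm_quad p).
Proof.
move=> z; have cx := continuous_std_x p z; have cy := continuous_std_y p z.
apply: cvgM; last exact: cvg_cst.
apply: cvgD; last exact: (cvgM cy cy).
apply: cvgB; first exact: (cvgM cx cx).
by apply: cvgM => //; apply: cvgM => //; exact: cvg_cst.
Qed.

Lemma continuous_binorm_pdf p : continuous (binorm_pdf p).
Proof.
move=> z; rewrite (funext (binorm_pdfE p)).
apply: cvgM; first exact: cvg_cst.
apply: (@continuous_comp _ _ _ (fun z => - binorm_quad p z) expR).
  exact: (cvgN (continuous_binorm_quad p z)).
exact: continuous_expR.
Qed.

Lemma continuous_ln_binorm_pdf p : admissible p ->
  continuous (fun z => ln (binorm_pdf p z)).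
Proof.
move=> ap z; apply: (@continuous_comp _ _ _ (binorm_pdf p) (@ln R)).
  exact: continuous_binorm_pdf.
by apply: continuous_ln; exact: binorm_pdf_gt0.
Qed.

Lemma measurable_std_x p : measurable_fun setT (std_x p).
Proof.
apply: measurable_funM; last exact: measurable_cst.
by apply: measurable_funB; [exact: measurable_fst|exact: measurable_cst].
Qed.

Lemma measurable_std_y p : measurable_fun setT (std_y p).
Proof.
apply: measurable_funM; last exact: measurable_cst.
by apply: measurable_funB; [exact: measurable_snd|exact: measurable_cst].
Qed.

Lemma measurable_binorm_pdf p : measurable_fun setT (binorm_pdf p).
Proof.
have mx := measurable_std_x p; have my := measurable_std_y p.
rewrite (funext (binorm_pdfE p)); apply: measurable_funM.
  exact: measurable_cst.
apply: (measurableT_comp (@measurable_expR R)).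
apply: measurable_funN; apply: measurable_funM; last exact: measurable_cst.
apply: measurable_funD; last exact: measurable_funX.
apply: measurable_funB; first exact: measurable_funX.
by apply: measurable_funM => //; apply: measurable_funM.
Qed.

Lemma measurable_ln_binorm_pdf p :
  measurable_fun setT (fun z => ln (binorm_pdf p z)).
Proof.
exact: (measurableT_comp (@measurable_ln R) (measurable_binorm_pdf p)).
Qed.

(** * Conditioning on X and total mass *)

(** Completing the square, u^2 - 2 rho u v + v^2 = (1 - rho^2) u^2 + (v - rho u)^2, separates the
    marginal of X from the conditional law of Y. By Tonelli the total mass then reduces to
    one-dimensional normal integrals. *)
Lemma binorm_pdf_cond p x y : admissible p ->
  binorm_pdf p (x, y) =
  normal_pdf (muX p) (sigX p) x *
  normal_pdf (muY p + rho p * sigY p * ((x - muX p) / sigX p))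
    (sigY p * Num.sqrt (1 - rho p ^+ 2)) y.
Proof.
move=> ap; have [sX [sY _]] := ap; have r0 := subr1_rho_gt0 _ ap.
have sr0 : 0 < Num.sqrt (1 - rho p ^+ 2) by rewrite sqrtr_gt0.
rewrite binorm_pdfE !normal_pdfE ?gt_eqF ?mulr_gt0//.
rewrite /normal_peak /normal_fun mulrACA -expRD; congr (_ * expR _).
  rewrite -invfM; congr (_^-1).
  have sqrt_var s : 0 < s ->
      Num.sqrt (s ^+ 2 * pi *+ 2) = s * Num.sqrt (pi *+ 2) :> R.
    by move=> s0; rewrite -mulrnAr sqrtrM ?sqr_ge0// sqrtr_sqr gtr0_norm.
  rewrite !sqrt_var ?mulr_gt0//.
  have pi2 : Num.sqrt (pi *+ 2) * Num.sqrt (pi *+ 2) = pi *+ 2 :> R.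
    by rewrite -expr2 sqr_sqrtr// mulrn_wge0// pi_ge0.
  move: pi2; rewrite /binorm_norm; set t := Num.sqrt (pi *+ 2) => <-.
  by ring.
rewrite exprMn sqr_sqrtr ?(ltW r0)//.
rewrite /binorm_quad /std_x /std_y/=.
by field; rewrite !gt_eqF// -mulr_natl mulr_gt0.
Qed.

Lemma integral_binorm_pdf p : admissible p ->
  (\int[leb2]_z (binorm_pdf p z)%:E = 1)%E.
Proof.
move=> ap; have [sX [sY _]] := ap; have r0 := subr1_rho_gt0 _ ap.
rewrite fubini_tonelli1/=; last 2 first.
- by apply/measurable_EFinP; exact: measurable_binorm_pdf.
- by move=> z; rewrite lee_fin ltW// binorm_pdf_gt0.
rewrite /fubini_F -[RHS](integral_normal_pdf (muX p) (sigX p)).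
apply: eq_integral => x _.
under eq_integral do rewrite binorm_pdf_cond// EFinM.
rewrite integralZl//; last exact: integrable_normal_pdf.
by rewrite integral_normal_pdf mule1.
Qed.

Lemma integrable_binorm_pdf p : admissible p ->
  leb2.-integrable setT (EFin \o binorm_pdf p).
Proof.
move=> ap; apply/integrableP; split.
  by apply/measurable_EFinP; exact: measurable_binorm_pdf.
under eq_integral do
  rewrite /= ger0_norm ?(ltW (binorm_pdf_gt0 _ _ ap))//.
by rewrite integral_binorm_pdf// ltry.
Qed.

(** * Functions of at most quadratic growth *)

Lemma sqr_affine_le (a b x : R) :
  (a * x + b) ^+ 2 <= 2 * (a ^+ 2 + b ^+ 2) * (1 + x ^+ 2).
Proof.
have := sqr_ge0 (a * x - b); have := sqr_ge0 a; have := sqr_ge0 (b * x).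
rewrite !expr2; lra.
Qed.

Lemma sqr_div_subr_le (m s x : R) :
  ((x - m) / s) ^+ 2 <= 2 * (s^-1 ^+ 2 + (m / s) ^+ 2) * (1 + x ^+ 2).
Proof.
have -> : (x - m) / s = s^-1 * x + - (m / s) by ring.
by rewrite -(sqrrN (m / s)); exact: sqr_affine_le.
Qed.

Lemma sqr_le_div_subr (m s x : R) : 0 < s ->
  x ^+ 2 <= 2 * (s ^+ 2 + m ^+ 2) * (1 + ((x - m) / s) ^+ 2).
Proof.
move=> s0; have xE : x = s * ((x - m) / s) + m by field; rewrite gt_eqF.
by rewrite {1}xE; exact: sqr_affine_le.
Qed.

(** A linear class containing the constants, [std_x] and the log-densities. Measurability is bundled
    in, so that membership alone gives integrability against every binormal density. *)
Definition quad_growth g : Prop :=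
  measurable_fun setT g /\
  exists K, 0 <= K /\ forall z, `|g z| <= K * (1 + z.1 ^+ 2 + z.2 ^+ 2).

Lemma quad_growthD f g : quad_growth f -> quad_growth g ->
  quad_growth (fun z => f z + g z).
Proof.
move=> [mf [K [K0 hK]]] [mg [L [L0 hL]]]; split; first exact: measurable_funD.
exists (K + L); split; first exact: addr_ge0.
by move=> z; rewrite (le_trans (ler_normD _ _))// mulrDl lerD.
Qed.

Lemma quad_growthZ (k : R) f : quad_growth f -> quad_growth (fun z => k * f z).
Proof.
move=> [mf [K [K0 hK]]]; split.
  by apply: measurable_funM => //; exact: measurable_cst.
exists (`|k| * K); split; first by rewrite mulr_ge0.
by move=> z; rewrite normrM -mulrA ler_wpM2l.
Qed.

Lemma quad_growth_cst (k : R) : quad_growth (fun=> k).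
Proof.
split; first exact: measurable_cst.
exists `|k|; split => // z; rewrite ler_peMr//.
by have := sqr_ge0 z.1; have := sqr_ge0 z.2; lra.
Qed.

Lemma quad_growthB f g : quad_growth f -> quad_growth g ->
  quad_growth (fun z => f z - g z).
Proof.
move=> hf hg; have := quad_growthD _ _ hf (quad_growthZ (-1) _ hg).
by congr quad_growth; apply/funext => z; rewrite mulN1r.
Qed.

Lemma sqr_std_le p : exists K, 0 <= K /\ forall z,
  std_x p z ^+ 2 + std_y p z ^+ 2 <= K * (1 + z.1 ^+ 2 + z.2 ^+ 2).
Proof.
set a := 2 * ((sigX p)^-1 ^+ 2 + (muX p / sigX p) ^+ 2).
set b := 2 * ((sigY p)^-1 ^+ 2 + (muY p / sigY p) ^+ 2).
have a0 : 0 <= a by rewrite mulr_ge0// addr_ge0// sqr_ge0.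
have b0 : 0 <= b by rewrite mulr_ge0// addr_ge0// sqr_ge0.
exists (a + b); split; first exact: addr_ge0.
move=> z; have hx : std_x p z ^+ 2 <= a * (1 + z.1 ^+ 2).
  exact: sqr_div_subr_le.
have hy : std_y p z ^+ 2 <= b * (1 + z.2 ^+ 2) by exact: sqr_div_subr_le.
apply: (le_trans (lerD hx hy)).
have := mulr_ge0 a0 (sqr_ge0 z.2); have := mulr_ge0 b0 (sqr_ge0 z.1); lra.
Qed.

(** Converts a growth bound in the raw coordinates into one in the coordinates in which the density
    of [p] decays. *)
Lemma std_sqr_ge p : admissible p -> exists K, 0 <= K /\ forall z,
  1 + z.1 ^+ 2 + z.2 ^+ 2 <= K * (1 + (std_x p z ^+ 2 + std_y p z ^+ 2)).
Proof.
move=> [sX [sY _]].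
set a := 2 * (sigX p ^+ 2 + muX p ^+ 2).
set b := 2 * (sigY p ^+ 2 + muY p ^+ 2).
have a0 : 0 <= a by rewrite mulr_ge0// addr_ge0// sqr_ge0.
have b0 : 0 <= b by rewrite mulr_ge0// addr_ge0// sqr_ge0.
exists (1 + a + b); split; first by rewrite !addr_ge0.
move=> z; have hx : z.1 ^+ 2 <= a * (1 + std_x p z ^+ 2).
  exact: sqr_le_div_subr.
have hy : z.2 ^+ 2 <= b * (1 + std_y p z ^+ 2) by exact: sqr_le_div_subr.
have := mulr_ge0 a0 (sqr_ge0 (std_y p z)).
have := mulr_ge0 b0 (sqr_ge0 (std_x p z)).
have := sqr_ge0 (std_x p z); have := sqr_ge0 (std_y p z); lra.
Qed.

Lemma quad_growth_std_x p : quad_growth (std_x p).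
Proof.
split; first exact: measurable_std_x.
have [K [K0 hK]] := sqr_std_le p; exists (1 + K); split; first lra.
move=> z; apply: (@le_trans _ _ (1 + std_x p z ^+ 2)).
  by have := sqr_ge0 (`|std_x p z| - 1); rewrite sqrrB1 real_normK ?num_real//;
    have := sqr_ge0 (std_x p z); lra.
have := hK z; have := sqr_ge0 (std_y p z).
have := sqr_ge0 z.1; have := sqr_ge0 z.2; lra.
Qed.

Lemma quad_growth_ln_binorm_pdf p : admissible p ->
  quad_growth (fun z => ln (binorm_pdf p z)).
Proof.
move=> ap; under eq_fun do rewrite ln_binorm_pdf//.
apply: quad_growthB; first exact: quad_growth_cst.
split.
  have mln := measurable_ln_binorm_pdf p.
  rewrite (_ : binorm_quad p =
    (fun z => - ln (binorm_norm p) - ln (binorm_pdf p z))).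
    by apply: measurable_funB => //; exact: measurable_cst.
  by apply/funext => z; rewrite ln_binorm_pdf//; ring.
have r0 := subr1_rho_gt0 _ ap; have [_ [_ hr]] := ap.
have [K [K0 hK]] := sqr_std_le p.
exists ((1 - rho p ^+ 2)^-1 * K); split.
  by rewrite mulr_ge0// invr_ge0 ltW.
move=> z; have := hK z; rewrite /binorm_quad.
move: (std_x p z) (std_y p z) => u v; set N := 1 + _ + _ => hN.
set D := 1 - rho p ^+ 2 in r0 *.
have D2 : 0 < D *+ 2 by rewrite mulrn_wgt0.
rewrite normrM normfV (gtr0_norm D2) ler_pdivrMr//.
have -> : D^-1 * K * N * (D *+ 2) = 2 * (K * N) by field; rewrite gt_eqF.
(* The cross term is absorbed by 2 |u| |v| <= u^2 + v^2 and |rho| < 1. *)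
have : `|(rho p *+ 2) * u * v| <= u ^+ 2 + v ^+ 2.
  rewrite !normrM normrMn -[u ^+ 2]real_normK ?num_real//.
  rewrite -[v ^+ 2]real_normK ?num_real//.
  have := sqr_ge0 (`|u| - `|v|); rewrite sqrrB.
  have : `|rho p| *+ 2 * `|u| * `|v| <= `|u| * `|v| *+ 2.
    by rewrite mulrnAl mulrnAl ler_wMn2r// -mulrA ler_piMl ?mulr_ge0// ltW.
  lra.
rewrite !ler_norml => /andP[h1 h2]; have := sqr_ge0 u; have := sqr_ge0 v.
by move=> *; apply/andP; split; lra.
Qed.

(** * Gaussian decay and integrability *)

(** The least eigenvalue of the form is 1 / (2 (1 + |rho|)), hence at least 1/4 uniformly in rho.
    After clearing denominators the gap is half of (u - rho v)^2 + (v - rho u)^2. *)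
Lemma binorm_quad_ge p z : admissible p ->
  (std_x p z ^+ 2 + std_y p z ^+ 2) / 4 <= binorm_quad p z.
Proof.
move=> ap; have r0 := subr1_rho_gt0 _ ap.
rewrite /binorm_quad; set u := std_x p z; set v := std_y p z.
rewrite ler_pdivlMr ?mulrn_wgt0//.
have := sqr_ge0 (u - rho p * v); have := sqr_ge0 (v - rho p * u); lra.
Qed.

(* [(1 + u^2 + v^2) exp (- (u^2 + v^2) / 4) <= 8 exp (- (u^2 + v^2) / 8)], and
   the right-hand side is proportional to the density of [dilate p]. *)
Definition dilate p : gparams R :=
  GP (muX p) (muY p) (2 * sigX p) (2 * sigY p) 0.

Lemma dilate_admissible p : admissible p -> admissible (dilate p).
Proof.
by move=> [sX [sY _]]; rewrite /admissible /dilate/= !mulr_gt0// normr0 ltr01.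
Qed.

Lemma binorm_quad_dilate p z : admissible p ->
  binorm_quad (dilate p) z = (std_x p z ^+ 2 + std_y p z ^+ 2) / 8.
Proof.
move=> [sX [sY _]]; rewrite /binorm_quad /std_x /std_y /dilate/=.
by field; rewrite !gt_eqF.
Qed.

Lemma integrable_binorm_pdfM p g : admissible p -> quad_growth g ->
  leb2.-integrable setT (EFin \o (fun z => binorm_pdf p z * g z)).
Proof.
move=> ap [mg [K [K0 hK]]]; have [L [L0 hL]] := std_sqr_ge p ap.
have n0 := binorm_norm_gt0 _ ap.
have aw := dilate_admissible p ap; have nw0 := binorm_norm_gt0 _ aw.
(* [K] and [L] come from the two growth bounds, 8 from 1 + t <= 8 exp (t / 8), and the rest is the
   ratio of the normalising constants. *)
set C := K * L * 8 * (binorm_norm p)^-1 * binorm_norm (dilate p).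
have C0 : 0 <= C.
  by rewrite /C mulr_ge0 ?(ltW nw0)// mulr_ge0 ?invr_ge0 ?(ltW n0)//
    mulr_ge0// mulr_ge0.
have iC : leb2.-integrable setT
    (EFin \o (fun z => C * binorm_pdf (dilate p) z)).
  exact: (integrableZl measurableT _ (integrable_binorm_pdf _ aw)).
apply: (le_integrable measurableT _ _ iC).
- apply/measurable_EFinP; apply: measurable_funM => //.
  exact: measurable_binorm_pdf.
- move=> z _; rewrite /= lee_fin normrM (gtr0_norm (binorm_pdf_gt0 p z ap)).
  rewrite [X in _ <= X]ger0_norm; last first.
    by rewrite mulr_ge0// ltW// binorm_pdf_gt0.
  rewrite !binorm_pdfE binorm_quad_dilate//.
  set t := std_x p z ^+ 2 + std_y p z ^+ 2.
  have ht : expR (- binorm_quad p z) <= expR (- (t / 4)).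
    by rewrite ler_expR lerN2; exact: binorm_quad_ge.
  have hg : `|g z| <= K * L * 8 * expR (t / 8).
    apply: (le_trans (hK z)); rewrite -!mulrA ler_wpM2l//.
    apply: (le_trans (hL z)); rewrite -/t ler_wpM2l//.
    move: (t) (expR_ge1Dx (t / 8)) => s; lra.
  have -> : C * ((binorm_norm (dilate p))^-1 * expR (- (t / 8))) =
      (binorm_norm p)^-1 * expR (- (t / 4)) * (K * L * 8 * expR (t / 8)).
    have -> : - (t / 8) = - (t / 4) + t / 8 by field.
    by rewrite expRD /C; field; rewrite !gt_eqF.
  rewrite ler_pM ?normr_ge0 ?mulr_ge0 ?expR_ge0 ?invr_ge0 ?(ltW n0)//.
  by rewrite ler_wpM2l// invr_ge0 ltW.
Qed.

(** A positive value at [z0] would keep [f] above half that value on a square of positive area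
    around [z0], making the integral positive. *)
Lemma continuous_Rintegral_eq0 (f : R * R -> R) :
  continuous f -> leb2.-integrable setT (EFin \o f) -> (forall z, 0 <= f z) ->
  \int[leb2]_z f z = 0 -> forall z, f z = 0.
Proof.
move=> cf iF f0 intf0 z0; apply/eqP; rewrite eq_le f0 andbT leNgt.
apply/negP => fz0.
have : \forall z \near z0, f z0 / 2 < f z.
  by apply: (cvgr_gt _ (cf z0)); lra.
move=> /nbhs_ballP[e /= e0 he].
pose S := ball z0.1 e `*` ball z0.2 e.
have mS : measurable S by apply: measurableX; exact: measurable_ball.
have leb2S : (leb2 S = (e *+ 2 * (e *+ 2))%:E)%E.
  transitivity (lebesgue_measure (ball z0.1 e) *
                lebesgue_measure (ball z0.2 e))%E.
    by apply: product_measure1E; exact: measurable_ball.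
  by rewrite !lebesgue_measure_ball ?ltW// -EFinM.
have intfE : (\int[leb2]_z (f z)%:E = 0)%E.
  rewrite -[LHS]fineK; last exact: integrable_fin_num.
  by rewrite -[fine _]/(\int[leb2]_z f z) intf0.
have : (\int[leb2]_z (f z0 / 2 * \1_S z)%:E <= \int[leb2]_z (f z)%:E)%E.
  have mI : measurable_fun setT (fun z : R * R => (f z0 / 2 * \1_S z)%:E).
    apply/measurable_EFinP; apply: measurable_funM; first exact: measurable_cst.
    exact: measurable_indic.
  have [mf _] := integrableP _ _ _ iF.
  apply: ge0_le_integral => //.
  - by move=> z _; rewrite lee_fin mulr_ge0// divr_ge0.
  move=> z _; rewrite lee_fin indicE; case: (boolP (z \in S)) => [|_].
    by rewrite inE mulr1 => -[zx zy]; apply/ltW/he.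
  by rewrite mulr0.
rewrite intfE; under eq_integral do rewrite EFinM.
have mS1 : measurable_fun setT (fun z : R * R => (\1_S z : R)%:E).
  by apply/measurable_EFinP; exact: measurable_indic.
rewrite ge0_integralZl//; last by rewrite lee_fin divr_ge0.
rewrite integral_indic// setIT [X in (_ * X)%E]leb2S -EFinM lee_fin leNgt.
move=> /negP; apply.
by rewrite !mulr_gt0// mulrn_wgt0.
Qed.

(** * Expectations under a binormal law *)

Definition expect p g : R := \int[leb2]_z (binorm_pdf p z * g z).

Lemma eq_expect p f g : f =1 g -> expect p f = expect p g.
Proof. by move=> /funext ->. Qed.

Lemma expectD p f g : admissible p -> quad_growth f -> quad_growth g ->
  expect p (fun z => f z + g z) = expect p f + expect p g.
Proof.
move=> ap hf hg; rewrite /expect -RintegralD//; last 2 first.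
- exact: integrable_binorm_pdfM.
- exact: integrable_binorm_pdfM.
by apply: eq_Rintegral => z _; rewrite mulrDr.
Qed.

Lemma expectZ p k f : admissible p -> quad_growth f ->
  expect p (fun z => k * f z) = k * expect p f.
Proof.
move=> ap hf; rewrite /expect -RintegralZl//; last first.
  exact: integrable_binorm_pdfM.
by apply: eq_Rintegral => z _; rewrite mulrCA.
Qed.

Lemma expect_cst p k : admissible p -> expect p (fun=> k) = k.
Proof.
move=> ap; rewrite /expect RintegralZr//; last exact: integrable_binorm_pdf.
by rewrite /Rintegral integral_binorm_pdf//= mul1r.
Qed.

Lemma expect_affine p k f c : admissible p -> quad_growth f ->
  expect p (fun z => k * f z + c) = k * expect p f + c.
Proof.
move=> ap hf; rewrite expectD ?expectZ ?expect_cst//.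
  exact: quad_growthZ.
exact: quad_growth_cst.
Qed.

(** * Exponential tilting and the mean of X *)

(* Exponential tilting by [d] times the standardised X coordinate. *)
Definition tilt p d : gparams R :=
  GP (muX p + d * sigX p) (muY p + rho p * d * sigY p)
    (sigX p) (sigY p) (rho p).

Lemma tilt_admissible p d : admissible p -> admissible (tilt p d).
Proof. by []. Qed.

(** The standardised mean moves by d (1, rho), that is d times the first column of the correlation
    matrix; the inverse matrix sends this to (d, 0), so the change is linear in u alone. *)
Lemma binorm_quad_tilt p d z : admissible p ->
  binorm_quad (tilt p d) z =
  binorm_quad p z - (d * std_x p z - d ^+ 2 / 2).
Proof.
move=> ap; have [sX [sY _]] := ap; have r0 := subr1_rho_gt0 _ ap.
rewrite /binorm_quad /std_x /std_y/=.
by field; rewrite !gt_eqF.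
Qed.

Lemma binorm_pdf_tilt p d z : admissible p ->
  binorm_pdf (tilt p d) z =
  binorm_pdf p z * expR (d * std_x p z - d ^+ 2 / 2).
Proof.
move=> ap; rewrite !binorm_pdfE binorm_quad_tilt// opprB addrC.
by rewrite expRD mulrA.
Qed.

Lemma ln_binorm_pdf_tilt p d z : admissible p ->
  ln (binorm_pdf (tilt p d) z) =
  ln (binorm_pdf p z) + d * std_x p z - d ^+ 2 / 2.
Proof.
move=> ap; rewrite binorm_pdf_tilt// lnM ?posrE ?expR_gt0 ?binorm_pdf_gt0//.
by rewrite expRK addrA.
Qed.

(* All tilted densities have mass 1 while [expR t >= 1 + t], so [M := E u]
   satisfies [d M <= d^2 / 2] for every [d]; take [d = M]. *)
Lemma expect_std_x p : admissible p -> expect p (std_x p) = 0.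
Proof.
move=> ap; set M := expect _ _.
have hu := quad_growth_std_x p.
have : expect p (fun z => M * std_x p z + (1 - M ^+ 2 / 2)) <=
       \int[leb2]_z binorm_pdf (tilt p M) z.
  apply: le_Rintegral => //.
  - apply: integrable_binorm_pdfM => //; apply: quad_growthD.
      exact: quad_growthZ.
    exact: quad_growth_cst.
  - exact: integrable_binorm_pdf.
  - move=> z _; rewrite binorm_pdf_tilt// ler_pM2l ?binorm_pdf_gt0//.
    have := expR_ge1Dx (M * std_x p z - M ^+ 2 / 2); lra.
rewrite expect_affine// /Rintegral integral_binorm_pdf//= -/M => h.
apply/eqP; rewrite -sqrf_eq0 eq_le sqr_ge0 andbT expr2.
by move: h; rewrite expr2; lra.
Qed.

(** [std_x p] is an affine function of [std_x q], which is centred under [q]. This brings the mean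
    constrained by the view into the entropy. *)
Lemma expect_std_x_other p q : admissible p -> admissible q ->
  expect q (std_x p) = (muX q - muX p) / sigX p.
Proof.
move=> [sX _] aq; have [tX _] := aq.
rewrite (eq_expect _ _
  (fun z => sigX q / sigX p * std_x q z + (muX q - muX p) / sigX p)).
  rewrite expect_affine ?expect_std_x ?mulr0 ?add0r//.
  exact: quad_growth_std_x.
by move=> z; rewrite /std_x; field; rewrite !gt_eqF.
Qed.

(** * Relative entropy: tilting identity and Gibbs' inequality *)

Definition kl q p : R :=
  expect q (fun z => ln (binorm_pdf q z) - ln (binorm_pdf p z)).

Lemma rel_entropyE q p : admissible q -> admissible p ->
  rel_entropy q p = (kl q p)%:E.
Proof.
move=> aq ap; rewrite /kl /expect /Rintegral fineK//.
apply: integrable_fin_num => //; apply: integrable_binorm_pdfM => //.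
by apply: quad_growthB; exact: quad_growth_ln_binorm_pdf.
Qed.

(** The two log-densities differ by d u - d^2 / 2; take expectations under [q]. Subtracting the case
    where [q] is the tilted law gives the Pythagorean identity. *)
Lemma kl_tilt q p d : admissible q -> admissible p ->
  kl q p = kl q (tilt p d) + (d * ((muX q - muX p) / sigX p) - d ^+ 2 / 2).
Proof.
move=> aq ap; have hp := quad_growth_ln_binorm_pdf p ap.
have ht := quad_growth_ln_binorm_pdf (tilt p d) ap.
have hq := quad_growth_ln_binorm_pdf q aq.
have hx := quad_growth_std_x p.
rewrite -expect_std_x_other// -expect_affine// /kl -expectD//.
- by apply: eq_expect => z; rewrite ln_binorm_pdf_tilt//; ring.
- exact: quad_growthB.
- by apply: quad_growthD; [exact: quad_growthZ|exact: quad_growth_cst].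
Qed.

Lemma kl_diag p : admissible p -> kl p p = 0.
Proof.
move=> ap; rewrite /kl (eq_expect _ _ (fun=> 0)) ?expect_cst// => z.
by rewrite subrr.
Qed.

(** With t = ln (b / a) the right-hand side is a (exp t - 1 - t), so its sign and its equality case
    both follow from exp t >= 1 + t, strict unless t = 0. *)
Lemma gibbs_integrandE (a b : R) : 0 < a -> 0 < b ->
  a * (ln a - ln b - 1) + b =
  a * (expR (ln b - ln a) - (1 + (ln b - ln a))).
Proof.
by move=> a0 b0; rewrite expRB !lnK//; field; rewrite gt_eqF.
Qed.

Lemma gibbs_integrand_ge0 (a b : R) : 0 < a -> 0 < b ->
  0 <= a * (ln a - ln b - 1) + b.
Proof.
move=> a0 b0; rewrite gibbs_integrandE// pmulr_rge0//.
by rewrite subr_ge0 expR_ge1Dx.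
Qed.

Lemma gibbs_integrand_eq0 (a b : R) : 0 < a -> 0 < b ->
  a * (ln a - ln b - 1) + b = 0 -> a = b.
Proof.
move=> a0 b0; rewrite gibbs_integrandE// => /eqP.
rewrite mulf_eq0 gt_eqF//= subr_eq0 => /eqP h.
apply: ln_inj => //; apply/esym/eqP; rewrite -subr_eq0.
by apply: contra_eqT h => /expR_gt1Dx h; rewrite gt_eqF.
Qed.

Lemma integrable_gibbs q p : admissible q -> admissible p ->
  leb2.-integrable setT (EFin \o (fun z => binorm_pdf q z *
    (ln (binorm_pdf q z) - ln (binorm_pdf p z) - 1))).
Proof.
move=> aq ap; apply: integrable_binorm_pdfM => //.
apply: quad_growthB; last exact: quad_growth_cst.
by apply: quad_growthB; exact: quad_growth_ln_binorm_pdf.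
Qed.

(** Adding the difference of the two densities leaves the integral unchanged, as both have mass 1,
    and makes the integrand pointwise nonnegative. *)
Lemma kl_gibbs q p : admissible q -> admissible p ->
  kl q p = \int[leb2]_z (binorm_pdf q z *
    (ln (binorm_pdf q z) - ln (binorm_pdf p z) - 1) + binorm_pdf p z).
Proof.
move=> aq ap; rewrite RintegralD//; last 2 first.
- exact: integrable_gibbs.
- exact: integrable_binorm_pdf.
rewrite [X in _ + X]/Rintegral integral_binorm_pdf//=.
have := expectD q _ _ aq (quad_growthB _ _ (quad_growth_ln_binorm_pdf q aq)
  (quad_growth_ln_binorm_pdf p ap)) (quad_growth_cst (-1)).
by rewrite expect_cst// -/(kl q p) {1}/expect => ->; rewrite subrK.
Qed.

Lemma kl_ge0 q p : admissible q -> admissible p -> 0 <= kl q p.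
Proof.
move=> aq ap; rewrite kl_gibbs//; apply: Rintegral_ge0 => z _.
by apply: gibbs_integrand_ge0; exact: binorm_pdf_gt0.
Qed.

(** The Gibbs integrand is continuous and nonnegative with zero integral, so it vanishes at every
    point, not merely almost everywhere. *)
Lemma kl_eq0 q p : admissible q -> admissible p -> kl q p = 0 ->
  forall z, binorm_pdf q z = binorm_pdf p z.
Proof.
move=> aq ap; rewrite kl_gibbs// => h z.
apply: gibbs_integrand_eq0; [exact: binorm_pdf_gt0..|].
move: z; apply: continuous_Rintegral_eq0 h.
- move=> z; apply: cvgD; last exact: continuous_binorm_pdf.
  apply: cvgM; first exact: continuous_binorm_pdf.
  apply: cvgB; last exact: cvg_cst.
  by apply: cvgB; exact: continuous_ln_binorm_pdf.
- exact: (integrableD measurableT (integrable_gibbs _ _ aq ap)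
    (integrable_binorm_pdf _ ap)).
- by move=> z; apply: gibbs_integrand_ge0; exact: binorm_pdf_gt0.
Qed.

(** * Recovering the Y parameters from the density *)

Lemma binorm_quad_mean p : binorm_quad p (muX p, muY p) = 0.
Proof.
rewrite /binorm_quad /std_x /std_y !subrr !mul0r mulr0 expr0n/=.
by rewrite subrr addr0 mul0r.
Qed.

Lemma binorm_quad_le0 p z : admissible p -> binorm_quad p z <= 0 ->
  z = (muX p, muY p).
Proof.
move=> ap h; have [sX [sY _]] := ap; have := binorm_quad_ge p z ap.
have := sqr_ge0 (std_x p z); have := sqr_ge0 (std_y p z) => hy hx hq.
have /eqP : std_x p z ^+ 2 = 0 by lra.
have /eqP : std_y p z ^+ 2 = 0 by lra.
rewrite !sqrf_eq0 !mulf_eq0 !invr_eq0 !subr_eq0 !(gt_eqF sX, gt_eqF sY) !orbF.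
by case: z {h hy hx hq} => x y /= /eqP -> /eqP ->.
Qed.

(** For fixed v the form is least at u = rho v, with value v^2 / 2. *)
Lemma binorm_quad_ge_y p z : admissible p ->
  std_y p z ^+ 2 / 2 <= binorm_quad p z.
Proof.
move=> ap; have r0 := subr1_rho_gt0 _ ap; rewrite /binorm_quad.
move: (std_x p z) (std_y p z) => u v.
rewrite ler_pdivlMr ?mulrn_wgt0//.
have := sqr_ge0 (u - rho p * v); lra.
Qed.

(** The equality case of the previous bound at v = 1: the sublevel set at height 1/2 reaches exactly
    [sigY p] above the mean in the y direction. *)
Lemma binorm_quad_ridge p : admissible p ->
  binorm_quad p (muX p + rho p * sigX p, muY p + sigY p) = 2^-1.
Proof.
move=> ap; have [sX [sY _]] := ap; have r0 := subr1_rho_gt0 _ ap.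
by rewrite /binorm_quad /std_x /std_y/=; field; rewrite !gt_eqF.
Qed.

Lemma binorm_quad_inj_sigY_le p q : admissible p -> admissible q ->
  muY p = muY q -> binorm_quad p =1 binorm_quad q -> sigY p <= sigY q.
Proof.
move=> ap aq hm hpq; have [_ [sY _]] := ap; have [_ [tY _]] := aq.
(* The lower bound for [q] is tested at the extremal point of [p]. *)
have := binorm_quad_ge_y _ (muX p + rho p * sigX p, muY p + sigY p) aq.
rewrite -hpq binorm_quad_ridge// /std_y/= hm addrAC subrr add0r => h.
have : (sigY p / sigY q) ^+ 2 <= 1 by lra.
by rewrite expr_le1 ?divr_ge0 ?(ltW sY) ?(ltW tY)// ler_pdivrMr// mul1r.
Qed.

Lemma binorm_pdf_inj_Y p q : admissible p -> admissible q ->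
  binorm_pdf p =1 binorm_pdf q -> muY p = muY q /\ sigY p = sigY q.
Proof.
move=> ap aq hpq.
pose k := ln (binorm_norm q) - ln (binorm_norm p).
have hk z : binorm_quad p z = binorm_quad q z + k.
  have : ln (binorm_pdf p z) = ln (binorm_pdf q z) by rewrite hpq.
  by rewrite !ln_binorm_pdf// /k; lra.
have quad_ge0 p' z : admissible p' -> 0 <= binorm_quad p' z.
  move=> ap'; apply: le_trans (binorm_quad_ge _ z ap').
  by rewrite divr_ge0// addr_ge0// sqr_ge0.
(* Both quadratic forms have minimum 0, attained at their means; evaluating at each mean in turn
   forces the additive constant to vanish. *)
have k_ge0 : 0 <= k.
  have := hk (muX q, muY q); rewrite binorm_quad_mean add0r => <-.
  exact: quad_ge0.
have k_le0 : k <= 0.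
  have := hk (muX p, muY p); rewrite binorm_quad_mean.
  by have := quad_ge0 q (muX p, muY p) aq; lra.
have k0 : k = 0 by lra.
have [_ hm] : (muX q, muY q) = (muX p, muY p).
  by apply: binorm_quad_le0 => //; rewrite hk binorm_quad_mean k0 addr0.
have hQ : binorm_quad p =1 binorm_quad q by move=> z; rewrite hk k0 addr0.
split=> //; apply/eqP; rewrite eq_le.
by rewrite !binorm_quad_inj_sigY_le// => z; rewrite hQ.
Qed.

(** * The tilted prior as posterior *)

(** The last hypothesis is the first-order optimality condition on the mean of X: it makes the
    linear term of the Pythagorean identity nonnegative over the whole view. *)
Lemma posterior_tilt p d (V : gparams R -> Prop) :
  admissible p -> V (tilt p d) ->
  (forall q, admissible q -> V q -> 0 <= d * (muX q - muX (tilt p d))) ->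
  is_posterior p V (tilt p d) /\
  forall pt, is_posterior p V pt ->
    muY pt = muY (tilt p d) /\ sigY pt = sigY p.
Proof.
move=> ap Vt hV; have atilt := tilt_admissible p d ap.
have [sX _] := ap.
have pyth q : admissible q -> kl q p =
    kl (tilt p d) p + (kl q (tilt p d) +
      d * (muX q - muX (tilt p d)) / sigX p).
  move=> aq; rewrite (kl_tilt q p d)// (kl_tilt (tilt p d) p d)//.
  by rewrite kl_diag//=; field; rewrite gt_eqF.
have corr q : admissible q -> V q ->
    0 <= d * (muX q - muX (tilt p d)) / sigX p.
  by move=> aq Vq; rewrite divr_ge0 ?hV// ltW.
(* Stated for abstract reals: [lra] on [kl] terms would unfold integrals. *)
have le_of_decomp (x y u v : R) : x = y + (u + v) -> 0 <= u -> 0 <= v -> y <= x.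
  by move=> -> u0 v0; rewrite lerDl addr_ge0.
have eq0_of_decomp (x y u v : R) :
    x = y + (u + v) -> 0 <= u -> 0 <= v -> x <= y -> u = 0 by lra.
have post : is_posterior p V (tilt p d).
  split; [exact: atilt|split=> [|q aq Vq]; first exact: Vt].
  rewrite (rel_entropyE _ _ atilt ap) (rel_entropyE _ _ aq ap) lee_fin.
  exact: (le_of_decomp _ _ _ _ (pyth q aq) (kl_ge0 q _ aq atilt)
    (corr q aq Vq)).
split=> // pt [apt [Vpt min]].
have := min _ atilt Vt.
rewrite (rel_entropyE _ _ apt ap) (rel_entropyE _ _ atilt ap) lee_fin.
move=> hle.
(* Another minimiser leaves no room for the two nonnegative excess terms, so its divergence from the
   tilted law is zero. *)
have h0 := eq0_of_decomp _ _ _ _ (pyth pt apt) (kl_ge0 pt _ apt atilt)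
  (corr pt apt Vpt) hle.
exact: (binorm_pdf_inj_Y _ _ apt atilt (kl_eq0 _ _ apt atilt h0)).
Qed.

End Binormal.

(** * CoVaR under equality and inequality views on the mean of X *)

Theorem theorem3p1 (R : realType) (mX mY sX sY r m1 a : R)
  (hsX : 0 < sX) (hsY : 0 < sY) (hr : `|r| < 1) (ha0 : 0 < a) (ha1 : a < 1) :
  let p := GP mX mY sX sY r in
  let covar_eq := mY + r * (m1 - mX) * (sY / sX) + sY * Phi_inv a in
  (* (i) equality view *)
  ((exists pt, is_posterior p (view_eq m1) pt) /\
   forall pt, is_posterior p (view_eq m1) pt -> CoVaR a pt = covar_eq) /\
  (* (ii) inequality view  muX~ <= m1 *)
  ((exists pt, is_posterior p (view_le m1) pt) /\
   forall pt, is_posterior p (view_le m1) pt ->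
     (mX <= m1 -> CoVaR a pt = VaR a p) /\ (m1 < mX -> CoVaR a pt = covar_eq)) /\
  (* (iii) inequality view  muX~ >= m1 *)
  ((exists pt, is_posterior p (view_ge m1) pt) /\
   forall pt, is_posterior p (view_ge m1) pt ->
     (m1 <= mX -> CoVaR a pt = VaR a p) /\ (mX < m1 -> CoVaR a pt = covar_eq)).
Proof.
move=> p covar_eq; have ap : admissible p by [].
(* The tilt that moves the mean of X from [mX] exactly to [m1]. *)
set d := (m1 - mX) / sX.
have muX_tilt : muX (tilt R p d) = m1 by rewrite /= /d; field; rewrite gt_eqF.
have muX_tilt0 : muX (tilt R p 0) = mX by rewrite /= mul0r addr0.
have CoVaR_tilt pt : muY pt = muY (tilt R p d) /\ sigY pt = sigY p ->
    CoVaR a pt = covar_eq.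
  by move=> [hm hs]; rewrite /CoVaR hm hs /covar_eq /d/=; field; rewrite gt_eqF.
have CoVaR_tilt0 pt : muY pt = muY (tilt R p 0) /\ sigY pt = sigY p ->
    CoVaR a pt = VaR a p.
  by move=> [hm hs]; rewrite /CoVaR /VaR hm hs /= mulr0 mul0r addr0.
have view_tilt (V : gparams R -> Prop) : V (tilt R p d) ->
    (forall q, V q -> 0 <= d * (muX q - m1)) ->
    (exists pt, is_posterior p V pt) /\
    forall pt, is_posterior p V pt -> CoVaR a pt = covar_eq.
  move=> Vt hV; have [|ex un] := posterior_tilt _ _ d V ap Vt.
    by move=> q _ /hV; rewrite muX_tilt.
  by split; [exists (tilt R p d)|move=> pt /un; exact: CoVaR_tilt].
(* When the prior already satisfies the view, d = 0 makes the optimality condition trivial. *)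
have view_tilt0 (V : gparams R -> Prop) : V (tilt R p 0) ->
    (exists pt, is_posterior p V pt) /\
    forall pt, is_posterior p V pt -> CoVaR a pt = VaR a p.
  move=> Vt; have [|ex un] := posterior_tilt _ _ 0 V ap Vt.
    by move=> q _ _; rewrite mul0r.
  by split; [exists (tilt R p 0)|move=> pt /un; exact: CoVaR_tilt0].
split; [|split].
- apply: view_tilt; first exact: muX_tilt.
  by move=> q ->; rewrite subrr mulr0.
- have [mm|mm] := leP mX m1.
    have [|ex un] := view_tilt0 (view_le m1).
      by rewrite /view_le muX_tilt0.
    by split=> // pt /un.
  have [| |ex un] := view_tilt (view_le m1); first by rewrite /view_le muX_tilt.
    (* The view binds: [d] is negative, and so is or vanishes [muX q - m1] for every feasible
       [q]. *)
    move=> q hq; rewrite mulr_le0// ?subr_le0//.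
    by rewrite /d pmulr_lle0 ?invr_gt0// subr_le0 ltW.
  by split=> // pt /un.
- have [mm|mm] := leP m1 mX.
    have [|ex un] := view_tilt0 (view_ge m1).
      by rewrite /view_ge muX_tilt0.
    by split=> // pt /un.
  have [| |ex un] := view_tilt (view_ge m1); first by rewrite /view_ge muX_tilt.
    (* The mirror case: both factors are nonnegative. *)
    move=> q hq; rewrite mulr_ge0// ?subr_ge0//.
    by apply: divr_ge0; rewrite ?subr_ge0 ltW.
  by split=> // pt /un.
Qed.
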